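(* Let $p\ge 1$ and $c>0$ be constants. For every $\beta\ge 0$ the boundary value problem $$x'''+c\,x^p\, x''=0\ \text{ on } [0,\infty),\qquad x(0)=0=x'(0),\qquad \lim_{t\to\infty}x'(t)=\beta$$ has a solution. *)

(* Defs.v *)
From HB Require Import structures.
From mathcomp Require Import all_boot all_order all_algebra.
From mathcomp Require Import all_classical all_reals all_analysis.
Set Implicit Arguments. Unset Strict Implicit. Unset Printing Implicit Defensive.
Import Order.TTheory GRing.Theory Num.Theory.
Import numFieldNormedType.Exports.
Local Open Scope ring_scope.
Local Open Scope classical_set_scope.

(* x is a solution on [0, +oo) of  x''' + c x^p x'' = 0,
   x(0) = 0 = x'(0),  lim_{t -> +oo} x'(t) = beta.
   x^p is the real power powR (x t `^ p); the solution is required to be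
   nonnegative on [0,+oo) so that x^p is the usual real power. *)
Definition bvp_solution (R : realType) (c p beta : R) (x : R -> R) : Prop :=
  [/\ (forall t : R, 0 <= t ->
         [/\ derivable x t 1, derivable (derive1 x) t 1, derivable (derive1n 2 x) t 1,
             0 <= x t &
             (derive1n 3 x) t + c * (x t `^ p) * (derive1n 2 x) t = 0]),
      x 0 = 0,
      (derive1 x) 0 = 0 &
      (derive1 x) t @[t --> +oo] --> beta].

(* Main.v *)
Require Import Defs.
From HB Require Import structures.
From mathcomp Require Import all_boot all_order all_algebra.
From mathcomp Require Import all_classical all_reals all_analysis.
From mathcomp Require Import ring lra.
Import Order.TTheory GRing.Theory Num.Theory.
Import numFieldNormedType.Exports.
Local Open Scope ring_scope.

(** It suffices to solve the initial value problem with x''(0) = 1. There the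
    equation reads x'' = exp (- c \int_0^t x^p), a fixed point equation for
    w = x'' among continuous functions with values in [0, 1]; Picard iteration
    contracts by 1/2 on [0, T] for the distance weighted by e^(-K t), with K
    depending on T. The velocity x' is nondecreasing, and it is bounded because
    x'' + c x' is eventually nonincreasing, hence it has a limit l > 0. Finally
    lam x(lam^p t) solves the same equation with limit velocity lam^(p+1) l. *)

(** * Two-sided primitives of continuous functions on the whole line *)

Section Primitive.
Context {R : realType}.
Implicit Types (f g F G : R -> R) (t T : R).

Lemma is_derive_continuous F (d t : R) : is_derive t 1 F d -> {for t, continuous F}.
Proof.
by move=> dF; apply/differentiable_continuous/derivable1_diffP/ex_derive.
Qed.

Lemma ge0_derive_le F f (a b : R) : a <= b ->
  (forall t, a <= t <= b -> is_derive t 1 F (f t)) ->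
  (forall t, a <= t <= b -> 0 <= f t) -> F a <= F b.
Proof.
move=> ab dF f0.
have dF' t : t \in `]a, b[ -> is_derive t 1 F (f t).
  by rewrite in_itv => /andP[/ltW at_ /ltW tb]; apply: dF; rewrite at_.
have [|t tab eF] := MVT_segment ab dF'.
  apply: continuous_in_subspaceT => t; rewrite inE/= in_itv/= => tab.
  exact/is_derive_continuous/dF.
by rewrite -subr_ge0 eF mulr_ge0 ?subr_ge0// f0// (itvP tab).
Qed.

(** The fundamental theorem of calculus applied on [[a, t + 1]], in which [t] is an interior point.
    It gives nothing at [a] itself or to its left. *)
Lemma half_line_primitive f (a : R) : continuous f ->
  exists F, forall t, a < t -> is_derive t 1 F (f t).
Proof.
move=> cf; exists (fun t => (\int[lebesgue_measure]_(s in `[a, t]) f s)%R) => t at_.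
have [||dF eF] := @continuous_FTC1_closed R f a t (t + 1) _ _ at_ (cf t).
- by rewrite ltrDl.
- apply: continuous_compact_integrable; first exact: segment_compact.
  exact: continuous_subspaceT.
by rewrite -eF derive1E; exact: derivableP.
Qed.

(** A primitive on the right half line is glued to a reflected primitive of [f (- t)]. Starting both
    at [-1] makes their domains overlap around [0], where the gluing needs a two-sided
    derivative. *)
Lemma primitive_exists f : continuous f ->
  exists F, F 0 = 0 /\ forall t, is_derive t 1 F (f t).
Proof.
move=> cf.
have [G dG] := half_line_primitive f (-1) cf.
have [|H dH] := half_line_primitive (fun t => f (- t)) (-1).
  by move=> t; apply: continuous_comp; [exact: opp_continuous|exact: cf].
have dH' t : t < 1 -> is_derive t 1 (fun s => - H (- s)) (f t).
  move=> t1.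
  have dHt : is_derive (- t) 1 H (f t).
    by rewrite -[in f t](opprK t); apply: dH; rewrite ltrN2.
  have := is_deriveN (is_derive1_comp dHt (is_deriveNid t 1)).
  by rewrite mulrN1 opprK.
(* On the overlap the two primitives differ by a constant: their difference and its opposite both
   have derivative [0], so both are nondecreasing. *)
have HG t : -1 < t < 0 -> - H (- t) + H 0 = G t - G 0.
  move=> /andP[t1 t0].
  have d s : t <= s <= 0 -> is_derive s 1 (fun u => - H (- u) - G u) 0.
    move=> /andP[ts s0]; rewrite -(subrr (f s)).
    apply: is_deriveB; first by apply: dH'; lra.
    by apply: dG; lra.
  have d' s : t <= s <= 0 -> is_derive s 1 (fun u => - (- H (- u) - G u)) 0.
    by move=> /d ds; rewrite -oppr0; apply: is_deriveN.
  have := ge0_derive_le _ _ _ _ (ltW t0) d (fun _ _ => lexx 0).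
  have := ge0_derive_le _ _ _ _ (ltW t0) d' (fun _ _ => lexx 0).
  rewrite oppr0; lra.
exists (fun t => if t < 0 then - H (- t) + H 0 else G t - G 0).
split; first by rewrite ltxx subrr.
move=> t; have [t0|t0] := ltP t 0.
  apply: (@near_eq_is_derive _ _ _ (fun s => - H (- s) + H 0)).
    near=> s; rewrite ifT//; near: s; exact: lt_nbhsl.
  rewrite -[f t]addr0; apply: is_deriveD; apply: dH'; lra.
(* For [t = 0] the neighbourhood also contains negative points, where [HG] shows that the other
   branch has the same value. *)
apply: (@near_eq_is_derive _ _ _ (fun s => G s - G 0)).
  near=> s; case: ifPn => // s0; rewrite HG// s0 andbT; near: s; apply: lt_nbhsr; lra.
rewrite -[f t]subr0; apply: is_deriveB; apply: dG; lra.
Unshelve. all: end_near. Qed.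

Definition primitive f : R -> R :=
  xget (fun=> 0) [set F | F 0 = 0 /\ forall t, is_derive t 1 F (f t)]%classic.

Lemma primitive0 f : continuous f -> primitive f 0 = 0.
Proof. by move=> /primitive_exists [F dF]; rewrite /primitive; case: xgetP => [_ _ []//|/(_ F)]. Qed.

Lemma is_derive_primitive f t : continuous f -> is_derive t 1 (primitive f) (f t).
Proof. by move=> /primitive_exists [F dF]; rewrite /primitive; case: xgetP => [_ _ []//|/(_ F)]. Qed.

Lemma continuous_primitive f : continuous f -> continuous (primitive f).
Proof. by move=> cf t; exact/is_derive_continuous/is_derive_primitive. Qed.

(** The bounds [- g <= f <= g] make both [G - F] and [G + F] nondecreasing; no integral of a norm is
    involved. *)
Lemma norm_derive_le F f G g T : 0 <= T -> 
  (forall t, is_derive t 1 F (f t)) -> (forall t, is_derive t 1 G (g t)) ->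
  (forall t, 0 <= t <= T -> `|f t| <= g t) -> `|F T - F 0| <= G T - G 0.
Proof.
move=> T0 dF dG fg.
have := ge0_derive_le (fun t => G t - F t) (fun t => g t - f t) 0 T T0
  (fun t _ => is_deriveB (dG t) (dF t)).
have := ge0_derive_le (fun t => G t + F t) (fun t => g t + f t) 0 T T0
  (fun t _ => is_deriveD (dG t) (dF t)).
move=> /(_ _)/wrap[t /fg|h1]; first by rewrite ler_norml; lra.
move=> /(_ _)/wrap[t /fg|h2]; first by rewrite ler_norml; lra.
by rewrite ler_norml; lra.
Qed.
End Primitive.

(** * Lipschitz estimates for real powers and the decaying exponential *)

Section Power.
Context {R : realType}.
Implicit Types (p M a b : R).

(** With [L] the Lipschitz constant, [L * x - x ^ p] is nondecreasing, because the derivative of the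
    power is at most [L] up to [M]. *)
Lemma powR_lipschitz p M a b : 1 <= p -> 0 <= a <= M -> 0 <= b <= M ->
  `|a `^ p - b `^ p| <= p * M `^ (p - 1) * `|a - b|.
Proof.
move=> p1; wlog ba : a b / b <= a => [wl ha hb|].
  have [/wl|/ltW/wl] := leP b a; first exact.
  by rewrite distrC (distrC a); apply.
move=> /andP[a0 aM] /andP[b0 bM].
have mono x y : 0 <= x -> x <= y -> x `^ (p - 1) <= y `^ (p - 1).
  move=> x0 xy; apply: ge0_ler_powR; rewrite ?nnegrE ?subr_ge0//.
  exact: le_trans x0 xy.
rewrite !ger0_norm ?subr_ge0//; last by apply: ge0_ler_powR; rewrite ?nnegrE//; lra.
(* The derivative formula for the power is used at positive points only. For [b = 0] the bound comes
   from [a ^ p = a * a ^ (p - 1)]. *)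
have [b_gt0|b_le0] := ltP 0 b; last first.
  have -> : b = 0 by apply/eqP; rewrite eq_le b0 b_le0.
  rewrite powR0 ?subr0; last by lra.
  rewrite -mulr_powRB1//; last by lra.
  rewrite [_ * a]mulrC; apply: ler_wpM2l => //.
  apply: (le_trans (mono _ _ a0 aM)).
  by rewrite ler_peMl// powR_ge0.
set L := p * _.
suff : L * b - b `^ p <= L * a - a `^ p by rewrite mulrBr; lra.
apply: (ge0_derive_le (fun x => L * x - x `^ p) (fun x => L - p * x `^ (p - 1)) b a) => //.
  move=> x /andP[bx xa]; apply: is_deriveB; last first.
    exact/is_derive1_powR/(lt_le_trans b_gt0).
  have := is_deriveZ L (is_derive_id x 1).
  by rewrite /GRing.scale/= mulr1.
move=> x /andP[bx xa]; rewrite subr_ge0 ler_pM2l; last by lra.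
by apply: mono; lra.
Qed.

(** The Lipschitz bound on [[0, g t + 1]] also covers the points where [g] vanishes. *)
Lemma continuous_powR (g : R -> R) p : 1 <= p -> continuous g ->
  (forall t, 0 <= g t) -> continuous (fun t => g t `^ p).
Proof.
move=> p1 cg g0 t.
pose L := p * (g t + 1) `^ (p - 1).
apply/cvgrPdist_le => e e0.
have L0 : 0 <= L by rewrite mulr_ge0 ?powR_ge0//; lra.
have L1 : 0 < L + 1 by lra.
near=> s.
have gs1 : `|g t - g s| <= 1.
  by near: s; move/cvgrPdist_le : (cg t); apply.
have gse : `|g t - g s| <= e / (L + 1).
  by near: s; move/cvgrPdist_le : (cg t); apply; rewrite divr_gt0.
have -> // : `|g t `^ p - g s `^ p| <= e.
apply: (le_trans (powR_lipschitz p (g t + 1) _ _ p1 _ _)).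
- by rewrite g0; lra.
- by rewrite g0; move: gs1; rewrite ler_norml; lra.
rewrite -/L (le_trans (ler_wpM2l L0 gse))// mulrCA ger_pMr// ler_pdivrMr//; lra.
Unshelve. all: end_near. Qed.

Lemma expRN_lipschitz a b : 0 <= a -> 0 <= b ->
  `|expR (- a) - expR (- b)| <= `|a - b|.
Proof.
wlog ba : a b / b <= a => [wl ha hb|a0 b0].
  have [/wl|/ltW/wl] := leP b a; first exact.
  by rewrite distrC (distrC a); apply.
rewrite distrC !ger0_norm ?subr_ge0 ?ler_expR ?lerN2//.
have -> : - a = - b + (b - a) by ring.
rewrite expRD -{1}[expR (- b)]mulr1 -mulrBr.
have h := expR_ge1Dx (b - a).
have h2 : expR (b - a) <= 1 by rewrite expR_le1 subr_le0.
have h3 : expR (- b) <= 1 by rewrite expR_le1 oppr_le0.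
apply: (@le_trans _ _ (1 - expR (b - a))); last by lra.
by rewrite ler_piMl// subr_ge0.
Qed.
End Power.

(** * Estimates for primitives, with an exponential weight *)

Section PrimitiveBounds.
Context {R : realType}.
Implicit Types (f g : R -> R) (t s T M C K : R).

Lemma primitive_bounds f M t : continuous f -> 0 <= t ->
  (forall s, 0 <= s <= t -> 0 <= f s <= M) -> 0 <= primitive f t <= M * t.
Proof.
move=> cf t0 fM.
have dP s := is_derive_primitive f s cf.
have := ge0_derive_le (primitive f) f 0 t t0 (fun s _ => dP s).
rewrite primitive0// => -> /=; last by move=> s /fM/andP[].
have := ge0_derive_le (fun s => M * s - primitive f s) (fun s => M - f s) 0 t t0.
rewrite primitive0// mulr0 subrr subr_ge0; apply => s; last first.
  by move=> /fM/andP[_]; rewrite subr_ge0.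
move=> _; apply: is_deriveB.
have := is_deriveZ M (is_derive_id s 1).
by rewrite /GRing.scale/= mulr1.
Qed.

(** Each integration gains a factor [1 / K] in the weighted distance, since [C / K * expR (K * s)]
    is a primitive of [C * expR (K * s)]. This gain is the source of the contraction. *)
Lemma primitive_close f g C K T : continuous f -> continuous g ->
  0 < K -> 0 <= C ->
  (forall s, 0 <= s <= T -> `|f s - g s| <= C * expR (K * s)) ->
  forall t, 0 <= t <= T -> `|primitive f t - primitive g t| <= C / K * expR (K * t).
Proof.
move=> cf cg K0 C0 fg t /andP[t0 tT].
have dG s : is_derive s 1 (fun s => C / K * expR (K * s)) (C * expR (K * s)).
  have dK : is_derive s 1 (fun s => K * s) K.
    have := is_deriveZ K (is_derive_id s 1).
    by rewrite /GRing.scale/= mulr1.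
  have := is_deriveZ (C / K) (is_derive1_comp (is_derive_expR _) dK).
  move=> h; apply: (is_derive_eq h); rewrite /GRing.scale/=.
  by field; rewrite gt_eqF.
have := norm_derive_le (fun s => primitive f s - primitive g s)
  (fun s => f s - g s) _ _ t t0
  (fun s => is_deriveB (is_derive_primitive f s cf) (is_derive_primitive g s cg)) dG.
rewrite !primitive0// !subr0 => h.
apply: (le_trans (h _)).
  by move=> s /andP[s0 st]; apply: fg; rewrite s0 (le_trans st).
by rewrite gerBl mulr_ge0 ?expR_ge0// divr_ge0// ltW.
Qed.

Lemma continuous_pospart : continuous (fun t : R => Num.max t 0).
Proof.
by move=> t; apply: (@continuous_max R R id (fun=> 0)) => //; exact: cvg_cst.
Qed.

Lemma pospart_ge0 t : 0 <= Num.max t 0.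
Proof. by rewrite le_max lexx orbT. Qed.

Lemma pospart_id t : 0 <= t -> Num.max t 0 = t.
Proof. by move=> /max_idPl. Qed.
End PrimitiveBounds.

(** * The Picard operator and its contraction property *)

Section Picard.
Context {R : realType} (p c : R) (p_ge1 : 1 <= p) (c_gt0 : 0 < c).
Implicit Types (w : R -> R) (t s T M C K : R).

(** The uniform bounds keep every displacement on [[0, T]] inside [[0, T ^ 2]], so one Lipschitz
    constant of the power serves for all iterates. *)
Definition admissible w := continuous w /\ forall t, 0 <= w t <= 1.

Definition displacement w := primitive (primitive w).

(* Freezing time at [0] for [t < 0] keeps everything continuous on the whole
   line, as the two-sided derivatives at [0] require. *)
Definition damping w t := c * displacement w (Num.max t 0) `^ p.

Definition picard w t := expR (- primitive (damping w) (Num.max t 0)).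

Lemma displacement_bounds w t : admissible w -> 0 <= t ->
  0 <= displacement w t <= t ^+ 2.
Proof.
move=> [cw w01] t0; rewrite expr2; apply: primitive_bounds => //.
  exact: continuous_primitive.
move=> s /andP[s0 st].
have /andP[-> h] := primitive_bounds w 1 s cw s0 (fun u _ => w01 u).
by apply: (le_trans h); rewrite mul1r.
Qed.

Lemma continuous_damping w : admissible w -> continuous (damping w).
Proof.
move=> aw t; apply: cvgM; first exact: cvg_cst.
apply: (continuous_powR (fun s => displacement w (Num.max s 0))) => //.
  move=> s; apply: (@continuous_comp _ _ _ (fun s => Num.max s 0)); first exact: continuous_pospart.
  by apply/continuous_primitive/continuous_primitive; case: aw.
move=> s; have /andP[] // := displacement_bounds w (Num.max s 0) aw (pospart_ge0 _).
Qed.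

Lemma damping_ge0 w t : 0 <= damping w t.
Proof. by rewrite mulr_ge0 ?powR_ge0 ?ltW. Qed.

Lemma primitive_damping_ge0 w t : admissible w -> 0 <= t ->
  0 <= primitive (damping w) t.
Proof.
move=> aw t0; have cd := continuous_damping w aw.
have := ge0_derive_le _ _ 0 t t0 (fun s _ => is_derive_primitive _ s cd).
by rewrite primitive0//; apply => s _; exact: damping_ge0.
Qed.

Lemma picard_admissible w : admissible w -> admissible (picard w).
Proof.
move=> aw; split=> t.
  apply: continuous_comp; last exact: continuous_expR.
  apply: cvgN; apply: (@continuous_comp _ _ _ (fun t => Num.max t 0)).
    exact: continuous_pospart.
  exact/continuous_primitive/continuous_damping.
by rewrite expR_ge0 expR_le1 oppr_le0 primitive_damping_ge0// pospart_ge0.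
Qed.

(** Passing from [w] to [picard w] takes three integrations, which gain [K ^ -3]. The power costs
    the factor [L], and the exponential costs nothing. *)
Lemma picard_contraction T : 0 <= T -> exists2 K, 0 < K &
  forall w1 w2 C, 0 <= C -> admissible w1 -> admissible w2 ->
  (forall s, 0 <= s <= T -> `|w1 s - w2 s| <= C * expR (K * s)) ->
  forall t, 0 <= t <= T -> `|picard w1 t - picard w2 t| <= C / 2 * expR (K * t).
Proof.
move=> T0; pose L := c * (p * (T ^+ 2) `^ (p - 1)).
have p_ge0 : 0 <= p := le_trans ler01 p_ge1.
have L0 : 0 <= L by rewrite !mulr_ge0 ?powR_ge0 ?(ltW c_gt0).
(* This choice gives [K >= 1] and [2 * L <= K <= K ^ 3], hence [L / K ^ 3 <= 1 / 2]. *)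
pose K := 1 + 2 * L; have K0 : 0 < K by rewrite /K; lra.
exists K => // w1 w2 C C0 aw1 aw2 w12 t tT.
have [[cw1 w1_] [cw2 w2_]] := (aw1, aw2).
have cv1 := continuous_primitive w1 cw1.
have cv2 := continuous_primitive w2 cw2.
have CK0 : 0 <= C / K by rewrite divr_ge0// ltW.
have CKK0 : 0 <= C / K / K by rewrite divr_ge0// ltW.
have h1 := primitive_close w1 w2 C K T cw1 cw2 K0 C0 w12.
have h2 := primitive_close _ _ _ K T cv1 cv2 K0 CK0 h1.
have h3 s : 0 <= s <= T -> `|damping w1 s - damping w2 s| <= L * (C / K / K) * expR (K * s).
  move=> sT; have /andP[s0 sT'] := sT.
  rewrite /damping -mulrBr normrM gtr0_norm// -[leRHS]mulrA -[leRHS]mulrA ler_pM2l//.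
  rewrite pospart_id//.
  have xT w : admissible w -> 0 <= displacement w s <= T ^+ 2.
    move=> aw; have /andP[-> h] := displacement_bounds w s aw s0.
    by rewrite (le_trans h)// lerXn2r// nnegrE.
  apply: (le_trans (powR_lipschitz p (T ^+ 2) _ _ p_ge1 (xT _ aw1) (xT _ aw2))).
  by apply: ler_wpM2l; [rewrite mulr_ge0 ?powR_ge0//; lra|exact: h2].
have LC0 : 0 <= L * (C / K / K) by rewrite mulr_ge0.
have cd1 := continuous_damping _ aw1; have cd2 := continuous_damping _ aw2.
have h4 := primitive_close _ _ _ K T cd1 cd2 K0 LC0 h3.
have /andP[t0 _] := tT.
rewrite /picard pospart_id//.
apply: (le_trans (expRN_lipschitz _ _ _ _)); try exact: primitive_damping_ge0.
apply: (le_trans (h4 t tT)); rewrite ler_pM2r ?expR_gt0//.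
have K1 : 1 <= K by rewrite /K; lra.
have -> : L * (C / K / K) / K = C * (L / K ^+ 3) by field; rewrite gt_eqF.
apply: ler_wpM2l => //; rewrite ler_pdivrMr ?exprn_gt0//.
have : K <= K ^+ 3 by rewrite exprS ler_peMr ?exprn_ege1// ltW.
by rewrite /K; lra.
Qed.
End Picard.

(** * Convergence of the iterates to a fixed point *)

Section PicardLimit.
Context {R : realType} (p c : R) (p_ge1 : 1 <= p) (c_gt0 : 0 < c).
Implicit Types (w : R -> R) (t T : R).

Let u n := iter n (picard p c) (fun=> 1).

Lemma picard_iter_admissible n : admissible (u n).
Proof.
elim: n => [|n IHn]; last exact: picard_admissible.
by split=> [t|t]; [exact: cvg_cst|rewrite ler01 lexx].
Qed.

(** The iterates are constant for [t <= 0], so bounds on [[0, T]] extend to all [t <= T], which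
    includes two-sided neighbourhoods of [0]. *)
Lemma picard_iter_pospart n t : u n (Num.max t 0) = u n t.
Proof. by case: n => //= n; rewrite /picard pospart_id// pospart_ge0. Qed.

Lemma picard_iter_cauchy T : 0 <= T -> exists2 E, 0 <= E &
  forall n m t, t <= T -> `|u (n + m)%N t - u n t| <= E * 2^-1 ^+ n.
Proof.
move=> T0; have [K K0 contr] := picard_contraction p c p_ge1 c_gt0 T T0.
(* The induction starts from two functions with values in [[0, 1]], whose distance is at most
   [1 <= expR (K * t)]. *)
have step n t : 0 <= t <= T -> `|u n.+1 t - u n t| <= 2^-1 ^+ n * expR (K * t).
  elim: n t => [t /andP[t0 _]|n IHn t tT].
    have /andP[a b] := (picard_iter_admissible 1).2 t.
    rewrite expr0 mul1r; apply: (@le_trans _ _ 1).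
      by rewrite ler_norml; move: a b; rewrite /u/=; lra.
    by rewrite -expR0 ler_expR mulr_ge0// ltW.
  by rewrite exprSr; apply: contr => //; [exact: (picard_iter_admissible n.+1)|exact: picard_iter_admissible].
pose E := 2 * expR (K * T).
have E0 : 0 <= E by rewrite mulr_ge0// expR_ge0.
exists E => // n m t tT.
rewrite -picard_iter_pospart -(picard_iter_pospart n).
set s := Num.max t 0.
have s0 : 0 <= s := pospart_ge0 t.
have sT : s <= T by rewrite ge_max tT.
have {}step k : `|u k.+1 s - u k s| <= E / 2 * 2^-1 ^+ k.
  apply: le_trans (step k s _) _; first by rewrite s0.
  rewrite mulrC ler_wpM2r ?exprn_ge0// /E mulrAC divff// mul1r.
  by rewrite ler_expR ler_pM2l.
(* The exact partial geometric sum is kept because the weaker bound without the last factor is not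
   inductive in [m]. *)
suff h : `|u (n + m)%N s - u n s| <= E * 2^-1 ^+ n * (1 - 2^-1 ^+ m).
  by apply: (le_trans h); rewrite ler_piMr// mulr_ge0.
elim: m => [|m IHm]; first by rewrite addn0 expr0 !subrr normr0 mulr0.
rewrite addnS; apply: (le_trans (ler_distD (u (n + m)%N s) _ _)).
apply: (le_trans (lerD (step _) IHm)).
by rewrite exprD exprS; set x := _ ^+ n; set y := _ ^+ m; lra.
Qed.

Lemma small_geometric (E e : R) : 0 < e -> exists n, E * 2^-1 ^+ n < e.
Proof.
move=> e0; have z1 : `|2^-1 : R| < 1 by rewrite ger0_norm//; lra.
have /cvgrPdist_lt/(_ e e0)[n _ h] := cvg_geometric E z1.
exists n; have := h n (leqnn n); rewrite /= sub0r normrN.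
exact/le_lt_trans/ler_norm.
Qed.

Let w t := limn (fun n => u n t).

Lemma picard_iter_limit T : 0 <= T -> exists2 E, 0 <= E &
  forall n t, t <= T -> `|w t - u n t| <= E * 2^-1 ^+ n.
Proof.
move=> T0; have [E E0 hE] := picard_iter_cauchy T T0.
exists E => // n t tT.
have cu : cvgn (fun n => u n t).
  apply/cauchy_cvgP/cauchy_exP => e e0.
  have [N hN] := small_geometric E e e0.
  exists (u N t); exists N => //= m Nm.
  rewrite -ball_normE/= distrC -(subnKC Nm).
  exact: le_lt_trans (hE _ _ _ tT) hN.
apply/ler_addgt0Pr => e e0.
have /cvgrPdist_le/(_ e e0)[N _ h] := cu.
have := h (n + N)%N (leq_addl _ _) => /= {}h.
apply: (le_trans (ler_distD (u (n + N)%N t) _ _)).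
by rewrite addrC lerD// hE.
Qed.

Lemma picard_fixpoint : exists w, admissible w /\ forall t, picard p c w t = w t.
Proof.
exists w.
(* Uniform approximation on each half line [t <= T]: it transfers bounds and continuity from the
   iterates to [w]. *)
have wu T e : 0 < e -> exists n, forall t, t <= T -> `|w t - u n t| <= e.
  move=> e0; have T0 : 0 <= Num.max T 0 := pospart_ge0 T.
  have [E _ hE] := picard_iter_limit _ T0; have [n hn] := small_geometric E e e0.
  exists n => t tT; apply: (le_trans (hE n t _)); last exact: ltW.
  by rewrite le_max tT.
have w01 t : 0 <= w t <= 1.
  apply/andP; split; apply/ler_addgt0Pr => e e0; have [n hn] := wu t e e0;
  have /andP[a b] := (picard_iter_admissible n).2 t;
  by have := hn t (lexx t); rewrite ler_norml; lra.
have aw : admissible w.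
  split=> // t; apply/cvgrPdist_le => e e0.
  have e3 : 0 < e / 3 by rewrite divr_gt0.
  have [n hn] := wu (t + 1) _ e3.
  near=> s.
  have st : s <= t + 1 by apply/ltW; near: s; apply: lt_nbhsl; rewrite ltrDl.
  have us : `|u n t - u n s| <= e / 3.
    by near: s; have /cvgrPdist_le := (picard_iter_admissible n).1 t; apply.
  have := hn s st; have := hn t; rewrite lerDl => /(_ ler01).
  by move: us; rewrite !ler_norml; lra.
split=> // t.
have wpos s : w (Num.max s 0) = w s.
  by congr (limn _); apply/funext => n; exact: picard_iter_pospart.
have ppos s : picard p c w (Num.max s 0) = picard p c w s.
  by rewrite /picard pospart_id// pospart_ge0.
rewrite -ppos -wpos; have := pospart_ge0 t; move: (Num.max t 0) => {}t t0.
have [K K0 contr] := picard_contraction p c p_ge1 c_gt0 t t0.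
have [E E0 hE] := picard_iter_limit t t0.
apply/eqP; rewrite -subr_eq0 -normr_le0; apply/ler_addgt0Pr => e e0; rewrite add0r.
(* [w] and [picard w] are both compared with [u n.+1]. The two errors add up to half of this
   constant times [2^-1 ^+ n]. *)
have [n hn] := small_geometric (E * expR (K * t) + E) e e0.
have h1 : `|w t - u n.+1 t| <= E * 2^-1 ^+ n.+1 by apply: hE.
have h2 : `|picard p c w t - u n.+1 t| <= E * 2^-1 ^+ n / 2 * expR (K * t).
  apply: contr; rewrite ?mulr_ge0 ?exprn_ge0 ?lexx ?t0//; first exact: picard_iter_admissible.
  move=> s /andP[s0 st]; apply: (le_trans (hE n s st)).
  rewrite ler_peMr ?mulr_ge0 ?exprn_ge0//.
  by rewrite -expR0 ler_expR mulr_ge0// ltW.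
apply: (le_trans (ler_distD (u n.+1 t) _ _)); rewrite [X in _ + X]distrC.
apply: (le_trans (lerD h2 h1)); apply: (le_trans _ (ltW hn)).
rewrite exprS -subr_ge0.
set x := _ ^+ n; set y := expR _.
have -> : (E * y + E) * x - (E * x / 2 * y + E * (2^-1 * x)) = (E * y + E) * x / 2 by field.
by rewrite !mulr_ge0 ?addr_ge0 ?mulr_ge0 ?expR_ge0 ?exprn_ge0 ?invr_ge0.
Unshelve. all: end_near. Qed.
End PicardLimit.

(** * The normalized initial value problem and its limit velocity *)

Section Blasius.
Context {R : realType} (p c : R) (p_ge1 : 1 <= p) (c_gt0 : 0 < c).
Implicit Types (f g w X V W : R -> R) (t s T : R).

(** The case [C = 0] of the weighted estimate. Agreement for [t >= 0] suffices, as primitives are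
    normalized at [0]. *)
Lemma eq_primitive f g : continuous f -> continuous g ->
  (forall t, 0 <= t -> f t = g t) ->
  forall t, 0 <= t -> primitive f t = primitive g t.
Proof.
move=> cf cg fg t t0.
have := primitive_close f g 0 1 t cf cg ltr01 (lexx 0) _ t.
rewrite !mul0r t0 lexx => h; apply/eqP; rewrite -subr_eq0 -normr_le0.
by apply: h => // s /andP[s0 _]; rewrite fg// subrr normr0 mul0r.
Qed.

Lemma normalized_solution : exists X V W,
  [/\ X 0 = 0, V 0 = 0,
      forall t, is_derive t 1 X (V t) /\ is_derive t 1 V (W t),
      forall t, 0 < W t &
      forall t, 0 <= t -> 0 <= X t /\ is_derive t 1 W (- c * X t `^ p * W t)].
Proof.
have [w [aw fw]] := picard_fixpoint p c p_ge1 c_gt0.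
have cw := aw.1.
have cd := continuous_damping p c p_ge1 w aw.
(* Without the truncation of [picard], the chain rule gives a two-sided derivative at every point,
   including [0]; for [t >= 0] this is still [w]. *)
pose W t := expR (- primitive (damping p c w) t).
have dW t : is_derive t 1 W (W t * - damping p c w t).
  exact: (is_derive1_comp (is_derive_expR _) (is_deriveN (is_derive_primitive _ t cd))).
have cW : continuous W by move=> t; exact: is_derive_continuous (dW t).
have cV := continuous_primitive W cW.
have WE t : 0 <= t -> W t = w t.
  by move=> t0; rewrite -fw /picard pospart_id.
have XE t : 0 <= t -> primitive (primitive W) t = displacement w t.
  apply: eq_primitive => //; first exact: continuous_primitive.
  exact: eq_primitive.
exists (primitive (primitive W)), (primitive W), W; split.
- exact: primitive0.
- exact: primitive0.
- by move=> t; split; exact: is_derive_primitive.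
- by move=> t; exact: expR_gt0.
move=> t t0; rewrite XE//; split.
  by have /andP[] := displacement_bounds w t aw t0.
apply: (is_derive_eq (dW t)); rewrite /damping pospart_id//; ring.
Qed.

Lemma normalized_velocity_bounded X V W : X 0 = 0 -> V 0 = 0 ->
  (forall t, is_derive t 1 X (V t) /\ is_derive t 1 V (W t)) ->
  (forall t, 0 < W t) ->
  (forall t, 0 <= t -> 0 <= X t /\ is_derive t 1 W (- c * X t `^ p * W t)) ->
  exists2 l : R, 0 < l & (V t @[t --> +oo] --> l)%classic.
Proof.
move=> X0 V0 dXV W0 dW.
have Vmono s t : s <= t -> V s <= V t.
  move=> st; apply: (ge0_derive_le V W s t st) => u _; first exact: (dXV u).2.
  exact: ltW.
(* [W] is nonincreasing on [[0, 1]], so integrating [W >= W 1] gives [V 1 >= W 1 > 0]. *)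
have V1 : 0 < V 1.
  have W1 t : 0 <= t <= 1 -> W 1 <= W t.
    move=> /andP[t0 t1]; rewrite -lerN2.
    apply: (ge0_derive_le (fun s => - W s) (fun s => - (- c * X s `^ p * W s)) t 1) => //.
      by move=> s /andP[ts _]; apply: is_deriveN; have [] := dW s (le_trans t0 ts).
    move=> s _; rewrite !mulNr opprK !mulr_ge0 ?powR_ge0 ?ltW//.
  have := ge0_derive_le (fun s => V s - W 1 * s) (fun s => W s - W 1) 0 1 ler01.
  rewrite V0 mulr0 subrr mulr1 subr_ge0 => h; apply: (lt_le_trans (W0 1)).
  apply: h => s s01; last by rewrite subr_ge0 W1.
  apply: is_deriveB; first exact: (dXV s).2.
  have := is_deriveZ (W 1) (is_derive_id s 1).
  by rewrite /GRing.scale/= mulr1.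
have Xlin t : 1 <= t -> V 1 * (t - 1) <= X t.
  move=> t1.
  have := ge0_derive_le (fun s => X s - V 1 * s) (fun s => V s - V 1) 1 t t1.
  have [X1 _] := dW 1 ler01.
  move=> h; suff : X 1 - V 1 * 1 <= X t - V 1 * t by lra.
  apply: h => s /andP[s1 _]; last by rewrite subr_ge0 Vmono.
  apply: is_deriveB; first exact: (dXV s).1.
  have := is_deriveZ (V 1) (is_derive_id s 1).
  by rewrite /GRing.scale/= mulr1.
(* The time at which the linear lower bound [V 1 * (t - 1)] for [X] reaches [1]. *)
pose T := 1 + (V 1)^-1.
have T1 : 1 <= T by rewrite lerDl invr_ge0 ltW.
have X_ge1 t : T <= t -> 1 <= X t.
  move=> Tt; apply: (le_trans _ (Xlin t (le_trans T1 Tt))).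
  by rewrite mulrC -ler_pdivrMr// div1r; move: Tt; rewrite /T; lra.
(* Once [1 <= X], [W' <= - c W], so [V + W / c] no longer increases. *)
have VT t : T <= t -> V t <= V T + W T / c.
  move=> Tt.
  have := ge0_derive_le (fun s => - (V s + c^-1 * W s))
    (fun s => - (W s + c^-1 * (- c * X s `^ p * W s))) T t Tt.
  have Wt : 0 <= c^-1 * W t by rewrite mulr_ge0 ?invr_ge0 ?ltW.
  rewrite lerN2 [_ / c]mulrC => h; apply: (@le_trans _ _ (V t + c^-1 * W t)).
    by rewrite lerDl.
  apply: h => s /andP[Ts st].
    apply: is_deriveN; apply: is_deriveD; first exact: (dXV s).2.
    apply: is_deriveZ; have [] // := dW s _.
    by rewrite (le_trans _ Ts)// (le_trans ler01).
  have -> : - (W s + c^-1 * (- c * X s `^ p * W s)) = W s * (X s `^ p - 1).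
    by field; rewrite gt_eqF.
  rewrite mulr_ge0 ?(ltW (W0 s))// subr_ge0 -(powRr0 (X s)) ler_powR ?X_ge1//.
  exact: le_trans p_ge1.
have ubV : has_ubound (range V).
  exists (V T + W T / c) => _ [t _ <-].
  have [/VT//|/ltW tT] := leP T t.
  by apply: (le_trans (Vmono _ _ tT)); rewrite lerDl divr_ge0 ?ltW.
exists (sup (range V)); last exact: nondecreasing_cvgr.
by apply: (lt_le_trans V1); apply: ub_le_sup => //; exists 1.
Qed.
End Blasius.

(** * Rescaling to the prescribed limit velocity *)

Theorem theorem1 (R : realType) (p c : R) (hp : 1 <= p) (hc : 0 < c) :
  forall beta : R, 0 <= beta -> exists x : R -> R, bvp_solution c p beta x.
Proof.
(* For [beta = 0] the zero function is a solution; the scaling below needs a positive factor. *)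
move=> beta; rewrite le_eqVlt => /predU1P[<-|beta0].
  have D0 : derive1 (fun=> 0 : R) = (fun=> 0).
    by apply/funext => t; rewrite derive1_cst.
  exists (fun=> 0); split=> // [t t0||]; rewrite ?D0//; last exact: cvg_cst.
  split; rewrite ?derive1nS /= ?D0//.
  by rewrite mulr0 addr0.
have [X [V [W [X0 V0 dXV W0 dW]]]] := normalized_solution p c hp hc.
have [l l0 Vl] := normalized_velocity_bounded p c hp hc X V W X0 V0 dXV W0 dW.
(* Chosen so that [lam ^ (p + 1) * l = beta], the limit velocity of the rescaled solution. *)
pose lam := (beta / l) `^ (p + 1)^-1.
have p1 : p + 1 != 0 by lra.
have lam0 : 0 < lam by rewrite powR_gt0// divr_gt0.
pose mu := lam `^ p; have mu0 : 0 < mu by rewrite powR_gt0.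
have lam_mu : lam * mu = beta / l.
  rewrite -[X in X * _]powRr1 1?ltW// -powRD; last by rewrite addrC (negPf p1).
  by rewrite -powRrM [1 + p]addrC mulVf// powRr1// divr_ge0 ?(ltW beta0) ?(ltW l0).
have dscale (F : R -> R) (a f k t : R) : is_derive (mu * t) 1 F f -> k = a * f * mu ->
    is_derive t 1 (fun s => a * F (mu * s)) k.
  move=> dF ->.
  have dmu : is_derive t 1 (fun s => mu * s) mu.
    have := is_deriveZ mu (is_derive_id t 1).
    by rewrite /GRing.scale/= mulr1.
  have := is_deriveZ a (is_derive1_comp dF dmu).
  by rewrite /GRing.scale/= mulrA.
pose x t := lam * X (mu * t).
have dx (t : R) : is_derive t 1 x (lam * mu * V (mu * t)).
  apply: dscale (dXV _).1 _; ring.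
have dx1 (t : R) : is_derive t 1 (fun s => lam * mu * V (mu * s)) (lam * mu ^+ 2 * W (mu * t)).
  apply: dscale (dXV _).2 _; ring.
have dx2 (t : R) : 0 <= t -> is_derive t 1 (fun s => lam * mu ^+ 2 * W (mu * s))
    (lam * mu ^+ 3 * (- c * X (mu * t) `^ p * W (mu * t))).
  move=> t0; apply: dscale (dW _ _).2 _; first by rewrite mulr_ge0// ltW.
  ring.
have x1E : derive1 x = fun s => lam * mu * V (mu * s).
  by apply/funext => t; rewrite derive1E; exact: derive_val.
have x2E : derive1 (fun s => lam * mu * V (mu * s)) = fun s => lam * mu ^+ 2 * W (mu * s).
  by apply/funext => t; rewrite derive1E; exact: derive_val.
exists x; split.
- move=> t t0; have mt0 : 0 <= mu * t by rewrite mulr_ge0// ltW.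
  have [Xt0 _] := dW _ mt0; have dx2t := dx2 t t0.
  rewrite /= x1E x2E; split=> //.
  + by rewrite mulr_ge0// ltW.
  (* The factor [lam ^ p] coming out of [x ^ p] is [mu], so both terms of the equation carry
     [lam * mu ^ 3] and cancel. *)
  + rewrite derive1E derive_val /x powRM// 1?ltW// -/mu; ring.
- by rewrite /x mulr0 X0 mulr0.
- by rewrite x1E mulr0 V0 mulr0.
rewrite x1E (_ : beta = lam * mu * l); last by rewrite lam_mu divfK// gt_eqF.
apply: cvgM; first exact: cvg_cst.
exact: cvg_comp (gt0_cvgMry mu0 cvg_id) Vl.
Qed.
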